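(* Let $m,d\in\mathbb N$, let $\mathcal K:=\mathbb N_0^m$ and let $\{P_{\mathbf n}\}_{\mathbf n\in\mathcal K}$ be a family of polynomials defining a polynomial hypergroup in $d$ variables on $\mathcal K$, with orthogonality measure $\pi$. Let $\alpha_{\mathbf x}\in\widehat{\mathcal K}$, $\alpha_{\mathbf x}(\mathbf n)=P_{\mathbf n}(\mathbf x)$ ($\mathbf x\in\mathbb C^d$), be such that $\pi(\{\alpha_{\mathbf x}\})=0$ (i.e. $\pi(\{\mathbf x\})=0$). If $\alpha_{\mathbf x}\in C_0(\mathcal K)$, then $\mathcal K$ is not $\alpha_{\mathbf x}$-amenable.
   Context: Polynomial hypergroup in $d$ variables: $\mathcal K=\mathbb N_0^m$ carries the discrete topology, $\{P_{\mathbf n}\}_{\mathbf n\in\mathcal K}$ is a set of polynomials in $\mathbb C[z_1,\dots,z_d]$ that are orthogonal with respect to a probability measure $\pi\in M^1(\mathbb C^d)$, and there is $u\in\mathbb C^d$ with $P_{\mathbf n}(u)=1$ for all $\mathbf n\in\mathcal K$. Let $\mathcal P_n$ be the set of polynomials in $\mathbb C[z_1,\dots,z_d]$ of degree at most $n$ and $\mathcal K_n=\{\mathbf n\in\mathcal K:P_{\mathbf n}\in\mathcal P_n\}$. It is assumed that: - for every $n\in\mathbb N$, $\{P_{\mathbf n}:\mathbf n\in\mathcal K_n\}$ is a basis of $\mathcal P_n$; - for all $\mathbf n,\mathbf m\in\mathcal K$ the (unique) linearization $P_{\mathbf n}P_{\mathbf m}=\sum_{\mathbf t\in\mathcal K}g(\mathbf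 n,\mathbf m,\mathbf t)P_{\mathbf t}$ has $g(\mathbf n,\mathbf m,\mathbf t)\ge0$; - there is a homeomorphism $\mathbf n\mapsto\tilde{\mathbf n}$ of $\mathcal K$ with $P_{\tilde{\mathbf n}}=\overline{P_{\mathbf n}}$ on the support of $\pi$ for every $\mathbf n\in\mathcal K$. Then $\mathcal K$ with convolution $p(\mathbf n,\mathbf m)(\{\mathbf t\})=g(\mathbf n,\mathbf m,\mathbf t)$ and involution $\mathbf n\mapsto\tilde{\mathbf n}$ is a commutative (discrete) hypergroup; its identity is $\mathbf 0$, the index of the constant polynomial $P_{\mathbf 0}\equiv1$. The set of hermitian characters is identified as $\widehat{\mathcal K}=\{\mathbf x\in\mathbb C^d:|\alpha_{\mathbf x}(\mathbf n)|\le1,\ \alpha_{\mathbf x}(\tilde{\mathbf n})=\overline{\alpha_{\mathbf x}(\mathbf n)}\ \forall\mathbf n\in\mathcal K\}$ with $\alpha_{\mathbf x}(\mathbf n):=P_{\mathbf n}(\mathbf x)$; under this identification $\pi$ is the Plancherel measure on $\widehat{\mathcal K}$. $C_0(\mathcal K)$ is the space of functions on the discrete set $\mathcal K$ vanishing at infinity. Translation: $T_{\mathbf n}f(\mathbf m)=\sum_{\mathbf t}g(\mathbf n,\mathbf m,\mathbf t)f(\mathbf t)$. For $\alpha\in\widehat{\mathcal K}$, $\mathcal K$ is called $\alpha$-amenable if there is a bounded linear functional $m_\alpha$ on $\ell^\infty(\mathcal K)$ with $m_\alpha(\alpha)=1$ and $m_\alpha(T_{\mathbf n}f)=\alpha(\mathbf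 n)m_\alpha(f)$ for all $f\in\ell^\infty(\mathcal K)$, $\mathbf n\in\mathcal K$. *)

(* Defs.v *)
From HB Require Import structures.
From mathcomp Require Import all_boot all_order all_algebra.
From mathcomp Require Import complex.
From mathcomp Require Import all_classical all_reals all_analysis.
(* The notations of mpoly clash with those of MathComp-Analysis. *)
From mathcomp Require Import -(notations) mpoly.

Set Implicit Arguments.
Unset Strict Implicit.
Unset Printing Implicit Defensive.

Import Order.TTheory GRing.Theory Num.Theory.
Import numFieldNormedType.Exports.

Local Open Scope classical_set_scope.
Local Open Scope ring_scope.

(* Usual topology of the complex plane, induced by the modulus. *)
HB.instance Definition _ (R : realType) := NormedModule.copy R[i] R[i]^o.

(* C^d with its Borel sigma-algebra. *)
Definition borelC (R : realType) (d : nat) :=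
  g_sigma_algebraType (@open 'rV[R[i]]_d).

(* Real-valued modulus; the norm `|z| of z : R[i] is (modulus z)%:C. *)
Notation modulus := ComplexField.Normc.normc.

Section ComplexIntegral.
Context {disp : measure_display} {T : measurableType disp} {R : realType}.
Variable mu : {measure set T -> \bar R}.

Definition cintegrable (f : T -> R[i]) : Prop :=
  mu.-integrable setT (EFin \o (fun x => complex.Re (f x))) /\
  mu.-integrable setT (EFin \o (fun x => complex.Im (f x))).

Definition cintegral (f : T -> R[i]) : R[i] :=
  Complex (\int[mu]_x complex.Re (f x)) (\int[mu]_x complex.Im (f x)).

End ComplexIntegral.

Section PolynomialHypergroup.
Context {R : realType} {m d : nat}.

Local Notation K := 'rV[nat]_m.

Definition peval (p : mpoly d R[i]) (x : 'rV[R[i]]_d) : R[i] :=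
  meval (fun i => x ord0 i) p.

(* msize is 1 + total degree, and 0 for the zero polynomial. *)
Definition degree_le (n : nat) (p : mpoly d R[i]) : Prop :=
  (msize p <= n.+1)%N.

Definition measure_support (pi : probability (borelC R d) R) :
    set 'rV[R[i]]_d :=
  [set x | forall U : set 'rV[R[i]]_d, open U -> U x -> (0 < pi U)%E].

Variable P : K -> mpoly d R[i].

Definition lin_indep_on (I : set K) : Prop :=
  forall (A : set K) (c : K -> R[i]), finite_set A -> A `<=` I ->
    \sum_(t \in A) c t *: P t = 0 -> forall t, A t -> c t = 0.

Definition spans (I : set K) (Q : set (mpoly d R[i])) : Prop :=
  forall p, Q p -> exists (A : set K) (c : K -> R[i]),
    [/\ finite_set A, A `<=` I & p = \sum_(t \in A) c t *: P t].

Definition index_le (n : nat) : set K := [set k | degree_le n (P k)].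

(* Each P n is square integrable with nonzero norm, and distinct members of
   the family are orthogonal in L^2(pi). *)
Definition orthogonal_family (pi : probability (borelC R d) R) : Prop :=
  forall n k : K,
    let f := fun x : borelC R d => peval (P n) x * (peval (P k) x)^*%C in
    cintegrable pi f /\ (cintegral pi f = 0 <-> n <> k).

Record polynomial_hypergroup (pi : probability (borelC R d) R)
    (g : K -> K -> K -> R[i]) (inv : K -> K) : Prop := {
  ph_orthogonal : orthogonal_family pi;
  ph_normalized : exists u, forall n, peval (P n) u = 1;
  ph_one : P 0 = 1;
  ph_indep : forall n, lin_indep_on (index_le n);
  ph_spans : forall n, spans (index_le n) (degree_le n);
  ph_finite : forall n k, finite_set [set t | g n k t != 0];
  ph_linearization :
    forall n k, P n * P k = \sum_(t \in [set: K]) g n k t *: P t;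
  (* In R[i], 0 <= z means that z is real and nonnegative. *)
  ph_ge0 : forall n k t, 0 <= g n k t;
  (* K is discrete, so its homeomorphisms are its bijections. *)
  ph_inv_bij : bijective inv;
  ph_inv : forall n x, measure_support pi x ->
    peval (P (inv n)) x = (peval (P n) x)^*%C }.

Definition alpha (x : 'rV[R[i]]_d) : K -> R[i] := fun n => peval (P n) x.

Definition hermitian_dual (inv : K -> K) : set 'rV[R[i]]_d :=
  [set x | forall n, modulus (alpha x n) <= 1 /\
                     alpha x (inv n) = (alpha x n)^*%C].

End PolynomialHypergroup.

Section Amenability.
Context {R : realType} {m : nat}.

Local Notation K := 'rV[nat]_m.

Definition vanishes_at_infinity (f : K -> R[i]) : Prop :=
  forall e : R, 0 < e -> finite_set [set n | e <= modulus (f n)].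

Definition linf (f : K -> R[i]) : Prop :=
  exists B : R, forall n, modulus (f n) <= B.

Definition linf_norm (f : K -> R[i]) : R :=
  sup (range (fun n => modulus (f n))).

Definition translation (g : K -> K -> K -> R[i]) (n : K) (f : K -> R[i]) :
    K -> R[i] :=
  fun k => \sum_(t \in [set: K]) g n k t * f t.

(* M stands for a functional on l^oo(K); its values on unbounded functions
   are irrelevant. *)
Definition bounded_functional (M : (K -> R[i]) -> R[i]) : Prop :=
  (forall (c : R[i]) f h, linf f -> linf h ->
     M (fun k => c * f k + h k) = c * M f + M h) /\
  (exists C : R, forall f, linf f -> modulus (M f) <= C * linf_norm f).

Definition amenable (g : K -> K -> K -> R[i]) (a : K -> R[i]) : Prop :=
  exists M : (K -> R[i]) -> R[i],
    [/\ bounded_functional M, M a = 1 &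
        forall f n, linf f -> M (translation g n f) = a n * M f].

End Amenability.

(* Main.v *)
Require Import Defs.
From HB Require Import structures.
From mathcomp Require Import all_boot all_order all_algebra.
From mathcomp Require Import complex.
From mathcomp Require Import all_classical all_reals all_analysis.
From mathcomp Require Import -(notations) mpoly.
From mathcomp Require Import measurable_realfun.

Import Order.TTheory GRing.Theory Num.Theory.
Import numFieldNormedType.Exports.

Local Open Scope classical_set_scope.
Local Open Scope ring_scope.

(* Let psi_0 = M(delta_0) for an invariant functional M.  Expanding a polynomial
   p in the P_t and translating delta_0 accordingly gives
     p(x) psi_0 = M(j |-> \int p P_j dpi),
   and |P_j| <= 1 a.e., so |p(x)| |psi_0| is bounded by a constant times
   \int |p| dpi.  As conj P_t = P_{inv t} a.e., there is a polynomial q with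
   q(x) = 1, 0 <= q <= 1 a.e. and {q = 1} reduced to {x} up to a null set.
   Since x is not an atom, \int q^k dpi -> 0 and hence psi_0 = 0.  Translating
   delta_0 by inv j yields a nonzero multiple of delta_j, so M vanishes on
   finitely supported functions, thus on C_0, whereas M(alpha_x) = 1. *)

(** * Modulus against real and imaginary parts *)

Lemma modulus_ge0 {R : realType} (z : R[i]) : 0 <= modulus z.
Proof. by case: z => a b; exact: sqrtr_ge0. Qed.

Lemma Re_le_modulus {R : realType} (z : R[i]) : `|complex.Re z| <= modulus z.
Proof.
by case: z => a b; rewrite -sqrtr_sqr /= ler_sqrt ?addr_ge0 ?sqr_ge0// lerDl sqr_ge0.
Qed.

Lemma Im_le_modulus {R : realType} (z : R[i]) : `|complex.Im z| <= modulus z.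
Proof.
by case: z => a b; rewrite -sqrtr_sqr /= ler_sqrt ?addr_ge0 ?sqr_ge0// lerDr sqr_ge0.
Qed.

Lemma modulus_le_ReIm {R : realType} (z : R[i]) :
  modulus z <= `|complex.Re z| + `|complex.Im z|.
Proof.
case: z => a b /=.
rewrite -[leRHS]ger0_norm ?addr_ge0// -sqrtr_sqr ler_sqrt ?sqr_ge0//.
rewrite sqrrD !real_normK ?num_real // -addrA lerD2l lerDr.
by rewrite mulrn_wge0 // mulr_ge0.
Qed.

(** * Full measure of the support *)

(** Second countability: each point off the support lies in a null ball with rational center and
    radius, and there are only countably many such balls. *)
Lemma negligible_setC_measure_support {R : realType} {d : nat}
    (pi : probability (borelC R d) R) :
  pi.-negligible (~` measure_support pi).
Proof.
pose c (q : 'rV[rat * rat]_d) : 'rV[R[i]]_d :=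
  \row_i Complex (ratr (q ord0 i).1) (ratr (q ord0 i).2).
pose B (qr : 'rV[rat * rat]_d * rat) : set 'rV[R[i]]_d :=
  ball (c qr.1) ((ratr qr.2 : R)%:C)%C.
(* The null rational balls, enumerated by codes; invalid codes and balls of positive measure give
   the empty set. *)
pose F (k : nat) : set (borelC R d) :=
  if unpickle k is Some qr then
    if pi (B qr) == 0%E then B qr else set0 else set0.
have mB qr : measurable (B qr : set (borelC R d)).
  by apply: sub_sigma_algebra; exact: ball_open.
apply: (@negligibleS _ _ _ pi (\bigcup_k F k)); last first.
  apply: negligible_bigcup => k; rewrite /F.
  case: (unpickle k) => [qr|]; last exact: negligible_set0.
  case: eqP => [pi0|_]; last exact: negligible_set0.
  exact/negligibleP.
move=> z /existsNP[U /not_implyP[oU /not_implyP[Uz /negP]]].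
rewrite lt0e measure_ge0 andbT negbK => /eqP piU.
have /nbhs_ballP[e /= e0 zeU] : nbhs z U by exact: open_nbhs_nbhs.
(* The radius is an element of [R[i]]; being positive, it has zero imaginary part, which leaves a
   real radius [r]. *)
move: e e0 zeU => [r s]; rewrite ltcE /= => /andP[/eqP-> r0] zeU.
(* A ball of radius [q < r / 2] that contains [z] lies in the [r]-ball around [z]. To have [z] in
   it, the real and imaginary parts of each coordinate are approximated within [q / 2]. *)
have [q] := @rat_in_itvoo _ 0 (r / 2) (divr_gt0 r0 (ltr0Sn _ 1)).
rewrite in_itv /= => /andP[q0 qr].
have approx (a : R) : exists p : rat, `|a - ratr p| < ratr q / 2.
  have [|p] := @rat_in_itvoo _ (a - ratr q / 2) (a + ratr q / 2).
    by rewrite ltrBlDr -addrA ltrDl addr_gt0// divr_gt0.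
  by rewrite in_itv /= -ltr_distlC => ?; exists p.
have /choice[p pE] : forall i, exists p : rat * rat,
    `|complex.Re (z ord0 i) - ratr p.1| < ratr q / 2 /\
    `|complex.Im (z ord0 i) - ratr p.2| < ratr q / 2 :> R.
  by move=> i; have [a ?] := approx (complex.Re (z ord0 i));
    have [b ?] := approx (complex.Im (z ord0 i)); exists (a, b).
pose qr' := (\row_i p i, q).
have zB : B qr' z.
  split=> [|i j]; first by rewrite ltcR.
  rewrite ord1 /ball /= !mxE /=; have [zre zim] := pE j.
  rewrite normc_def ltcR -/(modulus (Complex _ _)).
  apply: le_lt_trans (modulus_le_ReIm _) _ => /=.
  rewrite (splitr (ratr q)) ltrD//.
    by move: zre; case: (z ord0 j) => a b /=; rewrite distrC.
  by move: zim; case: (z ord0 j) => a b /=; rewrite distrC.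
have BU : B qr' `<=` U.
  move=> y yB; apply: zeU; have := ball_triangle (ball_sym zB) yB.
  apply: le_ball; rewrite lecE /= addr0 eqxx /=.
  by rewrite (splitr r) lerD ?ltW.
exists (pickle qr') => //; rewrite /F pickleK.
suff -> : pi (B qr') = 0%E by rewrite eqxx.
apply/eqP; rewrite -measure_le0 -piU le_measure ?inE//.
exact: sub_sigma_algebra.
Qed.

(** * Linearity of the complex integral *)

Section ComplexIntegralLinearity.
Context {disp : measure_display} {T : measurableType disp} {R : realType}.
Variable (mu : {measure set T -> \bar R}).

(** The common shape of both parts of [c * f + h]: the real part is
    [Re c * Re f - Im c * Im f + Re h], and the imaginary part is similar. *)
Local Lemma integrable_lincomb2 (a b : R) (f1 f2 f3 : T -> R) :
    mu.-integrable setT (EFin \o f1) -> mu.-integrable setT (EFin \o f2) ->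
    mu.-integrable setT (EFin \o f3) ->
  mu.-integrable setT (EFin \o (fun x => a * f1 x + b * f2 x + f3 x)) /\
  \int[mu]_x (a * f1 x + b * f2 x + f3 x) =
    a * \int[mu]_x f1 x + b * \int[mu]_x f2 x + \int[mu]_x f3 x.
Proof.
move=> i1 i2 i3.
have j1 : mu.-integrable setT (EFin \o (fun x => a * f1 x)).
  by apply: eq_integrable (integrableZl _ a i1).
have j2 : mu.-integrable setT (EFin \o (fun x => b * f2 x)).
  by apply: eq_integrable (integrableZl _ b i2).
have j12 : mu.-integrable setT (EFin \o (fun x => a * f1 x + b * f2 x)).
  by apply: eq_integrable (integrableD _ j1 j2).
split; first by apply: eq_integrable (integrableD _ j12 i3).
by rewrite !RintegralD// !RintegralZl.
Qed.

Lemma cintegrable_lincomb (c : R[i]) (f h : T -> R[i]) :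
  cintegrable mu f -> cintegrable mu h -> cintegrable mu (fun x => c * f x + h x).
Proof.
move=> [fr fi] [hr hi]; split.
- have [+ _] := integrable_lincomb2 (complex.Re c) (- complex.Im c) _ _ _ fr fi hr.
  apply: eq_integrable => // x _ /=.
  by case: c (f x) (h x) => [a b] [p q] [r s] /=; rewrite mulNr.
- have [+ _] := integrable_lincomb2 (complex.Re c) (complex.Im c) _ _ _ fi fr hi.
  apply: eq_integrable => // x _ /=.
  by case: c (f x) (h x) => [a b] [p q] [r s] /=.
Qed.

Lemma cintegral_lincomb (c : R[i]) (f h : T -> R[i]) :
    cintegrable mu f -> cintegrable mu h ->
  cintegral mu (fun x => c * f x + h x) = c * cintegral mu f + cintegral mu h.
Proof.
move=> [fr fi] [hr hi].
have [_ re] := integrable_lincomb2 (complex.Re c) (- complex.Im c) _ _ _ fr fi hr.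
have [_ im] := integrable_lincomb2 (complex.Re c) (complex.Im c) _ _ _ fi fr hi.
rewrite {2 3}/cintegral; case: c re im => a b /= re im; apply/eqP.
rewrite eq_complex /= -mulNr -re -im; apply/andP; split; apply/eqP;
  apply: eq_Rintegral => x _; case: (f x) (h x) => [p q] [r s] //=.
by rewrite mulNr.
Qed.

End ComplexIntegralLinearity.

(** * Algebra of the basis [P] and its integrals *)

Section PolynomialHypergroupTheory.
Context {R : realType} {m d : nat} {P : 'rV[nat]_m -> mpoly d R[i]}.
Context {mu : probability (borelC R d) R}.
Context {g : 'rV[nat]_m -> 'rV[nat]_m -> 'rV[nat]_m -> R[i]}.
Context {inv : 'rV[nat]_m -> 'rV[nat]_m}.
Hypothesis hP : polynomial_hypergroup P mu g inv.
Local Notation K := 'rV[nat]_m.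
Local Notation poly := (mpoly d R[i]).

Lemma pevalD (p q : poly) z : peval (p + q) z = peval p z + peval q z.
Proof. exact: mevalD. Qed.

Lemma pevalZ c (p : poly) z : peval (c *: p) z = c * peval p z.
Proof. exact: mevalZ. Qed.

Lemma pevalM (p q : poly) z : peval (p * q) z = peval p z * peval q z.
Proof. exact: mevalM. Qed.

Lemma peval1 z : peval (1 : poly) z = 1.
Proof. exact: meval1. Qed.

Lemma pevalXn (p : poly) k z : peval (p ^+ k) z = peval p z ^+ k.
Proof. by elim: k => [|k IH]; rewrite ?peval1 // !exprS pevalM IH. Qed.

(** Induction along an expansion in the [P t]: every polynomial has some finite degree bound, hence
    is a finite combination of them. *)
Lemma mpoly_ind_basis (Q : poly -> Prop) :
  Q 0 -> (forall t, Q (P t)) ->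
  (forall c p q, Q p -> Q q -> Q (c *: p + q)) -> forall p, Q p.
Proof.
move=> Q0 QP Qlin p.
have [|A [c [finA _ ->]]] := @ph_spans _ _ _ _ _ _ _ hP (msize p) p.
  exact: leqnSn.
rewrite fsbig_finite//=; elim: finmap.enum_fset => [|t s IH].
  by rewrite big_nil.
by rewrite big_cons; apply: Qlin.
Qed.

Local Notation L p := (cintegral mu (peval p : borelC R d -> R[i])).

(** Square integrability of the pair [P t], [P 0 = 1] is integrability of [P t]; linearity does the
    rest. *)
Lemma cintegrable_peval (p : poly) :
  cintegrable mu (peval p : borelC R d -> R[i]).
Proof.
have i0 : cintegrable mu (fun=> 0 : R[i]).
  by split; apply: eq_integrable (integrable0 _ _).
elim/mpoly_ind_basis: p => [|t|c p q ip iq].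
- by rewrite (_ : peval _ = fun=> 0)//; apply/funext => z; exact: meval0.
- have [+ _] := ph_orthogonal hP t 0; rewrite (ph_one hP).
  by under eq_fun do rewrite peval1 conjc1 mulr1.
- have := cintegrable_lincomb _ c _ _ ip iq.
  by under eq_fun do rewrite -pevalZ -pevalD.
Qed.

Lemma cintegral_pevalD c (p q : poly) : L (c *: p + q) = c * L p + L q.
Proof.
rewrite -cintegral_lincomb; try exact: cintegrable_peval.
by congr cintegral; apply/funext => z; rewrite pevalD pevalZ.
Qed.

Lemma cintegral_peval0 : L 0 = 0.
Proof. by have := cintegral_pevalD (-1) 0 0; rewrite scaler0 addr0 mulN1r addNr. Qed.

Lemma cintegral_peval1 : L 1 = 1.
Proof.
rewrite (_ : peval 1 = fun=> 1); last by apply/funext => z; exact: peval1.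
rewrite /cintegral /=.
rewrite !Rintegral_cst// mul0r mul1r.
by congr Complex; have /(congr1 fine) := @probability_setT _ _ _ mu; exact: etrans.
Qed.

(** Orthogonality of [P t] to the constant [P 0 = 1], together with total mass one. Thus the
    integral reads off the coefficient of [P 0]. *)
Lemma cintegral_basis t : L (P t) = (t == 0)%:R.
Proof.
case: eqP => [->|t0]; first by rewrite (ph_one hP) cintegral_peval1.
have [_ /iffRL/(_ t0)] := ph_orthogonal hP t 0; rewrite (ph_one hP).
by under eq_fun do rewrite peval1 conjc1 mulr1.
Qed.

(** Lists the finite support of [g n k], so that the linearization can be handled by induction on a
    list. *)
Lemma linearization_seq n k : exists2 s : seq K, uniq s &
  P n * P k = \sum_(t <- s) g n k t *: P t /\ forall t, t \notin s -> g n k t = 0.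
Proof.
have fing := ph_finite hP n k.
pose s := finmap.enum_fset (fset_set [set t | g n k t != 0]).
have us : uniq s by exact: finmap.fset_uniq.
have nin t : t \notin s -> g n k t = 0.
  apply: contraNeq => gt.
  by have := in_fset_set fing t; rewrite [t \in [set _ | _]]mem_set.
exists s => //; split=> //; rewrite (ph_linearization hP) (fsbigE s)//.
- by apply: eq_bigl => t; rewrite in_setT.
- by move=> t _ /nin ->; rewrite scale0r.
Qed.

Lemma linearization_coef0 n k : g n k 0 = L (P n * P k).
Proof.
have [s us [-> nin]] := linearization_seq n k.
transitivity (\sum_(t <- s) g n k t * L (P t)); last first.
  elim: {us nin} s => [|t s IH]; first by rewrite !big_nil cintegral_peval0.
  by rewrite !big_cons cintegral_pevalD IH.
have [s0|/nin g0] := boolP (0 \in s).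
  rewrite (bigD1_seq 0)//= big1 ?addr0 ?cintegral_basis ?eqxx ?mulr1// => t t0.
  by rewrite cintegral_basis (negPf t0) mulr0.
rewrite g0 big1_seq// => t /andP[_ ts].
rewrite cintegral_basis; case: eqP => [t0|]; last by rewrite mulr0.
by rewrite t0 g0 mul0r.
Qed.

Lemma translation_delta n k j : translation g n (fun t => (t == j)%:R) k = g n k j.
Proof.
rewrite /translation -(fsbig_widen [set j]) ?fsbig_set1 ?eqxx ?mulr1// => t /= [_].
by move/eqP/negPf => ->; rewrite mulr0.
Qed.

(** The cone generated by the [P t]. Nonnegativity of the linearization coefficients makes it closed
    under products. *)
Inductive positive_comb : poly -> Prop :=
| positive_comb0 : positive_comb 0
| positive_combS c t p :
    0 <= c -> positive_comb p -> positive_comb (c *: P t + p).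

Lemma positive_combD p q :
  positive_comb p -> positive_comb q -> positive_comb (p + q).
Proof.
move=> hp hq; elim: hp => [|c t r c0 _ IH]; first by rewrite add0r.
by rewrite -addrA; constructor.
Qed.

Lemma positive_combZ c p : 0 <= c -> positive_comb p -> positive_comb (c *: p).
Proof.
move=> c0; elim=> [|b t r b0 _ IH]; first by rewrite scaler0; constructor.
by rewrite scalerDr scalerA; constructor; rewrite ?mulr_ge0.
Qed.

Lemma positive_combM p q :
  positive_comb p -> positive_comb q -> positive_comb (p * q).
Proof.
have PP n k : positive_comb (P n * P k).
  have [s _ [-> _]] := linearization_seq n k.
  elim: s => [|t s IH]; rewrite ?big_nil ?big_cons; constructor => //.
  exact: ph_ge0 hP _ _ _.
move=> hp hq; elim: hp => [|c t r c0 _ IH]; first by rewrite mul0r; constructor.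
rewrite mulrDl -scalerAl; apply: positive_combD => //; apply: positive_combZ => //.
elim: hq => [|b k {}r b0 _ {}IH]; first by rewrite mulr0; constructor.
by rewrite mulrDr -scalerAr; apply: positive_combD => //; exact: positive_combZ.
Qed.

Lemma positive_comb_basis t : positive_comb (P t).
Proof.
rewrite -[P t]scale1r -[_ *: _]addr0.
by constructor; [exact: ler01|constructor].
Qed.

Lemma positive_combXn p k : positive_comb p -> positive_comb (p ^+ k).
Proof.
move=> hp; elim: k => [|k IH]; last by rewrite exprS; exact: positive_combM.
by rewrite expr0 -(ph_one hP); exact: positive_comb_basis.
Qed.

(** The integral is the coefficient of [P 0], while the value at [u] is the sum of all coefficients,
    which are nonnegative. *)
Lemma positive_comb_integral p u : (forall n, peval (P n) u = 1) ->
  positive_comb p -> 0 <= L p <= peval p u.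
Proof.
move=> Pu; elim=> [|c t r c0 _ /andP[r0 ru]].
  by rewrite cintegral_peval0 lexx (_ : peval _ _ = 0) ?lexx//; exact: meval0.
rewrite cintegral_pevalD cintegral_basis pevalD pevalZ Pu.
by rewrite addr_ge0 ?mulr_ge0 ?ler0n //= lerD// ler_wpM2l// lern1 leq_b1.
Qed.

End PolynomialHypergroupTheory.

(** * Almost everywhere estimates of integrals *)

Section AlmostEverywhere.
Context {disp : measure_display} {T : measurableType disp} {R : realType}.
Variable mu : probability T R.

Lemma ae_le_Rintegral (f1 f2 : T -> R) :
    mu.-integrable setT (EFin \o f1) -> mu.-integrable setT (EFin \o f2) ->
    {ae mu, forall z, f1 z <= f2 z} ->
  \int[mu]_z f1 z <= \int[mu]_z f2 z.
Proof.
move=> i1 i2 f12; rewrite -subr_ge0 -RintegralB//.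
have m12 : measurable_fun setT (fun z => f2 z - f1 z).
  apply: measurable_funB; apply/measurable_EFinP.
  - exact: measurable_int i2.
  - exact: measurable_int i1.
(* The difference is replaced by its positive part, which is equal to it almost everywhere and
   nonnegative everywhere. *)
rewrite /Rintegral (@ae_eq_integral _ _ _ _ _ (fun z => (Num.max (f2 z - f1 z) 0)%:E))//.
- by apply: fine_ge0; apply: integral_ge0 => z _; rewrite lee_fin le_max lexx orbT.
- exact/measurable_EFinP.
- by apply/measurable_EFinP; exact: measurable_maxr.
- apply: filterS f12 => z zle _; congr EFin.
  by rewrite max_l// subr_ge0.
Qed.

Lemma ae_eq_cintegral (f1 f2 : T -> R[i]) :
    cintegrable mu f1 -> cintegrable mu f2 ->
    {ae mu, forall z, f1 z = f2 z} ->
  cintegral mu f1 = cintegral mu f2.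
Proof.
move=> [r1 i1] [r2 i2] f12; congr Complex; apply/eqP; rewrite eq_le.
- by rewrite !ae_le_Rintegral//; apply: filterS f12 => z ->.
- by rewrite !ae_le_Rintegral//; apply: filterS f12 => z ->.
Qed.

(** The real and imaginary parts are estimated separately, whence the factor 2; it is harmless where
    the bound tends to zero. *)
Lemma modulus_cintegral_le (f : T -> R[i]) (h : T -> R) :
    cintegrable mu f -> mu.-integrable setT (EFin \o h) ->
    {ae mu, forall z, modulus (f z) <= h z} ->
  modulus (cintegral mu f) <= 2 * \int[mu]_z h z.
Proof.
move=> [fr fi] ih fh; apply: le_trans (modulus_le_ReIm _) _.
rewrite mulr_natl mulr2n lerD//=.
- apply: le_trans (le_normr_Rintegral measurableT fr) _.
  apply: ae_le_Rintegral => //; first by apply: eq_integrable (integrable_abse fr).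
  by apply: filterS fh => z; apply: le_trans; exact: Re_le_modulus.
- apply: le_trans (le_normr_Rintegral measurableT fi) _.
  apply: ae_le_Rintegral => //; first by apply: eq_integrable (integrable_abse fi).
  by apply: filterS fh => z; apply: le_trans; exact: Im_le_modulus.
Qed.

(** A Bernoulli-type inequality, [k (f - 1) <= f ^ k]: bounded moments leave no mass on the set
    where [f > 1]. The [v k] are integrable versions of the powers of [f]. *)
Lemma ae_le1_of_moments (f : T -> R) (v : nat -> T -> R) :
    measurable_fun setT f -> (forall z, 0 <= f z) ->
    (forall k, mu.-integrable setT (EFin \o v k)) ->
    (forall k, {ae mu, forall z, v k z = f z ^+ k}) ->
    (forall k, \int[mu]_z v k z <= 1) ->
  {ae mu, forall z, f z <= 1}.
Proof.
move=> mf f0 iv vE v1.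
(* The excess of [f] over 1, cut off at 1 so that it is bounded and hence integrable; it is positive
   exactly where [f > 1]. *)
pose h z := Num.min (Num.max (f z - 1) 0) 1.
have h0 z : 0 <= h z by rewrite le_min le_max lexx orbT ler01.
have mh : measurable_fun setT h.
  apply: measurable_minr => //; apply: measurable_maxr => //.
  exact: measurable_funB.
have ih : mu.-integrable setT (EFin \o h).
  apply: measurable_bounded_integrable => //.
    exact: le_lt_trans (probability_le1 mu measurableT) (ltry 1).
  exists 1; split=> // M M1 z _ /=; rewrite ger0_norm//.
  by rewrite (le_trans _ (ltW M1))// ge_min lexx orbT.
have kh k : k%:R * \int[mu]_z h z <= 1.
  rewrite -RintegralZl//; apply: le_trans (v1 k); apply: ae_le_Rintegral => //.
    by apply: eq_integrable (integrableZl _ k%:R ih).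
  apply: filterS (vE k) => z ->.
  have [f1|/ltW f1] := leP (f z) 1.
    by rewrite /h max_r ?subr_le0// min_l ?ler01// mulr0 exprn_ge0.
  apply: (@le_trans _ _ (k%:R * (f z - 1))).
    by rewrite ler_wpM2l// ge_min max_l ?lexx// subr_ge0.
  elim: k => [|k IH]; first by rewrite mul0r.
  have -> : f z ^+ k.+1 = f z ^+ k + (f z - 1) * f z ^+ k.
    by rewrite mulrBl mul1r addrCA subrr addr0 exprS.
  by rewrite -natr1 mulrDl mul1r lerD// ler_peMr ?subr_ge0// exprn_ege1.
have ih0 : \int[mu]_z h z = 0.
  apply/eqP; rewrite eq_le Rintegral_ge0// andbT leNgt; apply/negP => hp.
  have := archi_boundP (ltW (divr_gt0 ltr01 hp)).
  by rewrite ltr_pdivrMr// ltNge kh.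
have : (\int[mu]_z `|(h z)%:E| = 0)%E.
  under eq_integral do rewrite gee0_abs ?lee_fin//.
  by rewrite -(fineK (integrable_fin_num measurableT ih)) -[fine _]/(Rintegral _ _ _) ih0.
have mEh : measurable_fun setT (EFin \o h) by exact/measurable_EFinP.
move/(ae_eq_integral_abs mu measurableT mEh); apply: filterS => z /(_ I)[/eqP].
rewrite leNgt; apply: contraL => f1.
by rewrite gt_eqF// lt_min lt_max subr_gt0 f1 ltr01.
Qed.

(** Dominated convergence with the constant 1 as dominating function. *)
Lemma Rintegral_powers_small (f : T -> R) (v : nat -> T -> R) (e : R) :
    0 < e -> (forall k, mu.-integrable setT (EFin \o v k)) ->
    {ae mu, forall z, forall k, v k z = f z ^+ k} ->
    {ae mu, forall z, 0 <= f z < 1} ->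
  exists k, \int[mu]_z v k z < e.
Proof.
move=> e0 iv vE f01.
have mv k : measurable_fun setT (fun z => (v k z)%:E) by exact: measurable_int (iv k).
have i1 : mu.-integrable setT (cst 1%E : T -> \bar R).
  exact: (finite_measure_integrable_cst mu 1).
have v0 : {ae mu, forall z, setT z -> (v k z)%:E @[k --> \oo] --> cst 0%E z}.
  apply: filterS2 vE f01 => z vz /andP[f0 f1] _; apply: cvg_EFin; first exact: nearW.
  rewrite (_ : fine \o _ = GRing.exp (f z)); last by apply/funext => k /=; rewrite vz.
  by apply: cvg_expr; rewrite ger0_norm.
have v1 : {ae mu, forall z, forall k, setT z -> (`|(v k z)%:E| <= cst 1%E z)%E}.
  apply: filterS2 vE f01 => z vz /andP[f0 f1] k _.
  by rewrite vz lee_fin ger0_norm ?exprn_ge0// exprn_ile1// ltW.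
have [_ _] := dominated_convergence measurableT mv (measurable_cst _) v0 i1 v1.
rewrite integral0 => /fine_cvg/cvgr_lt/(_ e e0)[k _ /(_ k (leqnn k))] /= ve.
by exists k.
Qed.

End AlmostEverywhere.

(** * Bounds on the basis and peak polynomials *)

Section PolynomialHypergroupMeasure.
Context {R : realType} {m d : nat} {P : 'rV[nat]_m -> mpoly d R[i]}.
Context {mu : probability (borelC R d) R}.
Context {g : 'rV[nat]_m -> 'rV[nat]_m -> 'rV[nat]_m -> R[i]}.
Context {inv : 'rV[nat]_m -> 'rV[nat]_m}.
Hypothesis hP : polynomial_hypergroup P mu g inv.
Local Notation K := 'rV[nat]_m.
Local Notation poly := (mpoly d R[i]).
Local Notation L p := (cintegral mu (peval p : borelC R d -> R[i])).

#[local] Instance ae_filter_borelC : Filter (almost_everywhere mu).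
Proof. exact: ae_filter_ringOfSetsType. Qed.

Lemma ae_peval_inv n :
  {ae mu, forall z : borelC R d, peval (P (inv n)) z = (peval (P n) z)^*%C}.
Proof.
have aeS : {ae mu, forall z : borelC R d, measure_support mu z}.
  exact: negligible_setC_measure_support.
by apply: filterS aeS => z; exact: (ph_inv hP).
Qed.

Lemma mulc_conj (a : R[i]) : a * a^*%C = ((modulus a ^+ 2)%:C)%C.
Proof.
case: a => a b; rewrite /= sqr_sqrtr ?addr_ge0 ?sqr_ge0//.
by apply/eqP; rewrite eq_complex /= !mulrN opprK -!expr2 (mulrC b) addNr !eqxx.
Qed.

Lemma real_complexXn (r : R) k : ((r ^+ k)%:C = r%:C ^+ k)%C.
Proof. exact: rmorphXn. Qed.

(* The moments of [|P n|^2 = P n * P (inv n)] are at most 1: they are constant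
   coefficients of nonnegative combinations of the [P t] with total mass 1. *)
Lemma ae_basis_le1 n : {ae mu, forall z : borelC R d, modulus (peval (P n) z) <= 1}.
Proof.
pose w := P n * P (inv n).
have [u Pu] := ph_normalized hP.
have mP : measurable_fun setT (fun z : borelC R d => modulus (peval (P n) z) ^+ 2).
  have [/measurable_int/measurable_EFinP mr /measurable_int/measurable_EFinP mi] :=
    cintegrable_peval hP (P n).
  apply: eq_measurable_fun (measurable_funD (measurable_funX 2 mr) (measurable_funX 2 mi)).
  by move=> z _ /=; case: (peval _ z) => a b; rewrite /= sqr_sqrtr ?addr_ge0 ?sqr_ge0.
suff : {ae mu, forall z : borelC R d, modulus (peval (P n) z) ^+ 2 <= 1}.
  apply: filterS => z; rewrite -[leRHS](expr1n _ 2) ler_pXn2r ?nnegrE//.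
  exact: modulus_ge0.
apply: (ae_le1_of_moments mu _ (fun k (z : borelC R d) =>
  complex.Re (peval (w ^+ k) z)) mP).
- by move=> z; exact: sqr_ge0.
- by move=> k; have [] := cintegrable_peval hP (w ^+ k).
- move=> k; apply: filterS (ae_peval_inv n) => z zE.
  by rewrite pevalXn pevalM zE mulc_conj -real_complexXn.
- move=> k.
  have /andP[_] := positive_comb_integral hP _ u Pu (positive_combXn hP _ k
    (positive_combM hP _ _ (positive_comb_basis n) (positive_comb_basis (inv n)))).
  by rewrite pevalXn pevalM !Pu mulr1 expr1n lecE => /andP[].
Qed.

(** Since [P j] is almost everywhere the conjugate of [P (inv j)], the coefficient [g n j 0] is the
    inner product of [P n] and [P (inv j)], to which orthogonality applies. *)
Lemma linearization_coef0_inv n j : (g (inv j) j 0 != 0) /\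
  (n <> inv j -> g n j 0 = 0).
Proof.
have gE k : g k j 0 = cintegral mu
    (fun z : borelC R d => peval (P k) z * (peval (P (inv j)) z)^*%C).
  rewrite (linearization_coef0 hP); apply: ae_eq_cintegral.
  - exact: (cintegrable_peval hP).
  - by have [] := ph_orthogonal hP k (inv j).
  - by apply: filterS (ae_peval_inv j) => z ->; rewrite conjcK pevalM.
have orth k := proj2 (ph_orthogonal hP k (inv j)).
split; last by move=> kj; rewrite gE; apply/orth.
by apply/eqP; rewrite gE => /orth.
Qed.

(** Up to a null set, [q] reaches its maximum 1 only where [p] takes its value at [x]. Keeping [p]
    as a parameter allows an induction over polynomials. *)
Definition peaks (x : 'rV[R[i]]_d) (p : poly) (q : poly) : Prop :=
  peval q x = 1 /\
  {ae mu, forall z : borelC R d, 0 <= peval q z <= 1 /\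
     (peval q z = 1 -> peval p z = peval p x)}.

Lemma peak_mul (a b : R[i]) : 0 <= a <= 1 -> 0 <= b <= 1 ->
  0 <= a * b <= 1 /\ (a * b = 1 -> a = 1 /\ b = 1).
Proof.
move=> /andP[a0 a1] /andP[b0 b1]; rewrite mulr_ge0// mulr_ile1//; split=> // ab.
split; apply/eqP; rewrite eq_le ?a1 ?b1 /= -ab; first by rewrite ler_piMr.
by rewrite ler_piMl.
Qed.

Lemma exists_peak (x : 'rV[R[i]]_d) (p : poly) :
  hermitian_dual P inv x -> exists q, peaks x p q.
Proof.
move=> hx; elim/(mpoly_ind_basis hP): p => [|t|c p1 p2 [q1 [q1x h1]] [q2 [q2x h2]]].
- exists 1; split; first exact: peval1.
  apply: filterS (ae_basis_le1 0) => z _.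
  by rewrite peval1 ler01 lexx; split=> // _; rewrite /peval !meval0.
(* [1 - |P t - P t x|^2 / 4], which is a polynomial almost everywhere. *)
- pose a := peval (P t) x; have [a1 aV] := hx t; rewrite /alpha -/a in a1 aV.
  pose q : poly := - (4%:R^-1)%:C%C *:
    ((P t + - a *: 1) * (P (inv t) + - (a^*)%C *: 1)) + 1.
  have qE z : peval q z = - (4%:R^-1)%:C%C *
      ((peval (P t) z - a) * (peval (P (inv t)) z - (a^*)%C)) + 1.
    by rewrite !(pevalD, pevalZ, pevalM, peval1) !mulr1.
  exists q; split; first by rewrite qE subrr mul0r mulr0 add0r.
  apply: filterS2 (ae_basis_le1 t) (ae_peval_inv t) => z z1 zV.
  set b := peval (P t) z in z1 zV *.
  (* Both [a] and [b] have modulus at most 1; this explains the factor 1/4 in [q]. *)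
  have s2 : modulus (b - a) <= 2.
    by apply: le_trans (le_normcD _ _) _; rewrite normcN (natrD _ 1 1) lerD.
  have s0 : 0 <= modulus (b - a) by exact: modulus_ge0.
  rewrite qE zV -rmorphB mulc_conj; set s := modulus (b - a) in s0 s2 *.
  have -> : - (4%:R^-1)%:C%C * (s ^+ 2)%:C%C + 1 = (1 - s ^+ 2 / 4%:R)%:C%C.
    by rewrite mulNr addrC -rmorphM (mulrC (s ^+ 2)) [RHS]rmorphB.
  have s4 : s ^+ 2 / 4%:R <= 1.
    by rewrite ler_pdivrMr// mul1r (natrM _ 2 2) -expr2 ler_sqr ?nnegrE.
  rewrite !lecR subr_ge0 s4 gerBl divr_ge0 ?sqr_ge0//; split=> // /eqP.
  rewrite eq_complex /= eqxx andbT -subr_eq0 addrAC subrr add0r oppr_eq0.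
  rewrite mulf_eq0 invr_eq0 pnatr_eq0 orbF sqrf_eq0.
  move=> /eqP/ComplexField.Normc.eq0_normc/eqP.
  by rewrite subr_eq0 => /eqP.
(* A product of two values in [0, 1] is 1 only if both are, so [p1] and [p2] both take their values
   at [x], and so does the combination. *)
- exists (q1 * q2); split; first by rewrite pevalM q1x q2x mulr1.
  apply: filterS2 h1 h2 => z [z1 e1] [z2 e2]; rewrite pevalM.
  have [? e] := peak_mul _ _ z1 z2; split=> // /e[/e1 ? /e2 ?].
  by rewrite !pevalD !pevalZ; congr (_ * _ + _).
Qed.

(** Multiplying peaks for all coordinate functions confines the set where [q = 1] to the point [x],
    up to a null set; that point is itself null. *)
Lemma exists_strict_peak (x : 'rV[R[i]]_d) : hermitian_dual P inv x ->
  mu [set x] = 0%E -> exists q : poly, peval q x = 1 /\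
    {ae mu, forall z : borelC R d, 0 <= peval q z < 1}.
Proof.
move=> hx mux.
have [q [qx hq]] : exists q : poly, peval q x = 1 /\
    {ae mu, forall z : borelC R d, 0 <= peval q z <= 1 /\
       (peval q z = 1 -> forall i, i \in enum 'I_d -> z ord0 i = x ord0 i)}.
  elim: (enum 'I_d) => [|i s [q [qx hq]]].
    (* With no coordinate to separate, any peak will do, so the zero polynomial is taken. *)
    have [q [qx hq]] := exists_peak x 0 hx; exists q; split=> //.
    by apply: filterS hq => z [].
  have [r [rx hr]] := exists_peak x (mpolyX _ (mnm1 i)) hx.
  exists (r * q); split; first by rewrite pevalM qx rx mulr1.
  apply: filterS2 hr hq => z [z1 e1] [z2 e2]; rewrite pevalM.
  have [? e] := peak_mul _ _ z1 z2; split=> // /e[/e1 zx /e2 zs] j.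
  rewrite inE => /predU1P[->|/zs//].
  by move: zx; rewrite /peval !mevalXU.
exists q; split=> //.
have nx : {ae mu, forall z : borelC R d, z <> x}.
  have mx : measurable ([set x] : set (borelC R d)).
    rewrite -(setCK [set x]); apply: measurableC; apply: sub_sigma_algebra.
    apply: closed_openC; apply: accessible_closed_set1.
    exact/hausdorff_accessible/norm_hausdorff.
  by exists [set x]; split=> // z /contrapT.
apply: filterS2 hq nx => z [/andP[-> q1] qz] zx.
rewrite lt_neqAle q1 andbT; apply/eqP => /qz zE; apply: zx.
by apply/rowP => i; rewrite zE// mem_enum.
Qed.

End PolynomialHypergroupMeasure.

(** * Bounded functionals on bounded functions *)

Section BoundedFunctional.
Context {R : realType} {m : nat}.
Local Notation K := 'rV[nat]_m.

Lemma linf0 : linf (fun _ : K => 0 : R[i]).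
Proof. by exists 0 => k; rewrite ComplexField.Normc.normc0. Qed.

Lemma linf_delta (j : K) : linf (fun k : K => (k == j)%:R : R[i]).
Proof.
exists 1 => k; case: eqP => _; rewrite ?ComplexField.Normc.normc1//.
by rewrite ComplexField.Normc.normc0 ler01.
Qed.

Variable M : (K -> R[i]) -> R[i].
Hypothesis bM : bounded_functional M.

(** Replaces the supremum norm by an arbitrary uniform bound; the absolute value of the given
    constant makes it nonnegative. *)
Lemma bounded_functional_le : exists2 C, 0 <= C &
  forall f B, (forall n, modulus (f n) <= B) -> modulus (M f) <= C * B.
Proof.
have [_ [C MC]] := bM; exists `|C| => // f B fB.
have lf : linf f by exists B.
apply: le_trans (MC f lf) _.
have B0 : 0 <= B by exact: le_trans (modulus_ge0 _) (fB 0).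
have fle : linf_norm f <= B.
  by apply: ge_sup; [exists (modulus (f 0)); exists 0|move=> _ [n _ <-]].
have f0 : 0 <= linf_norm f.
  apply: le_trans (modulus_ge0 (f 0)) _; apply: ub_le_sup; last by exists 0.
  by exists B => _ [n _ <-].
by apply: le_trans (ler_wpM2r f0 (ler_norm C)) _; rewrite ler_wpM2l.
Qed.

Lemma bounded_functional0 : M (fun=> 0) = 0.
Proof.
have /= := proj1 bM (-1) _ _ linf0 linf0.
under [X in M X]eq_fun do rewrite mulr0 addr0.
by rewrite mulN1r addNr.
Qed.

(** Functions vanishing at infinity are uniform limits of their finitely supported restrictions,
    which [M] kills. *)
Lemma bounded_functional_C0 (f : K -> R[i]) : vanishes_at_infinity f ->
  (forall j, M (fun k => (k == j)%:R) = 0) -> M f = 0.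
Proof.
move=> f0 Mdelta; have [C C0 MC] := bounded_functional_le.
have lfin (s : seq K) : linf (fun k => if k \in s then f k else 0) /\
    M (fun k => if k \in s then f k else 0) = 0.
  elim: s => [|t s [ls Ms]].
    by split; [exact: linf0|exact: bounded_functional0].
  have [ts|ts] := boolP (t \in s).
    rewrite (_ : (fun k => _) = fun k => if k \in s then f k else 0)//.
    by apply/funext => k; rewrite inE; case: eqP => // ->; rewrite ts.
  rewrite (_ : (fun k => _) = fun k => f t * (k == t)%:R +
      (if k \in s then f k else 0)); last first.
    apply/funext => k; rewrite inE; case: eqP => [->|_] /=.
      by rewrite (negPf ts) mulr1 addr0.
    by rewrite mulr0 add0r.
  rewrite (proj1 bM _ _ _ (linf_delta t) ls) Mdelta mulr0 add0r; split=> //.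
  have [B sB] := ls; exists (modulus (f t) + B) => k.
  apply: le_trans (le_normcD _ _) _; rewrite lerD// ComplexField.Normc.normcM.
  rewrite ler_piMr ?modulus_ge0//; case: eqP => _.
    by rewrite ComplexField.Normc.normc1.
  by rewrite ComplexField.Normc.normc0 ler01.
apply: ComplexField.Normc.eq0_normc; apply/eqP; rewrite eq_le modulus_ge0 andbT.
apply/ler_addgt0Pl => e e0; rewrite addr0.
(* Adding 1 keeps the divisor positive when [C = 0]. Off the finite set [F], [f] is below
   [e / (C + 1)], so the remainder [r] contributes at most [e]. *)
have C1 : 0 < C + 1 by rewrite ltr_wpDl.
pose F := finmap.enum_fset (fset_set [set n | e / (C + 1) <= modulus (f n)]).
have [lF MF] := lfin F.
pose r k := if k \in F then 0 else f k.
have rle k : modulus (r k) <= e / (C + 1).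
  rewrite /r; case: ifPn => [_|kF].
    by rewrite ComplexField.Normc.normc0 divr_ge0 ?ltW.
  rewrite leNgt; apply: contraNN kF => kf.
  have := in_fset_set (f0 _ (divr_gt0 e0 C1)) k.
  by rewrite [k \in [set _ | _]]mem_set//= ltW.
rewrite (_ : f = fun k => 1 * r k + (if k \in F then f k else 0)); last first.
  by apply/funext => k; rewrite /r; case: ifP; rewrite mul1r ?add0r ?addr0.
rewrite (proj1 bM)//; last by exists (e / (C + 1)).
rewrite MF mul1r addr0; apply: le_trans (MC _ _ rle) _.
by rewrite mulrA ler_pdivrMr// mulrC ler_pM2l// lerDl.
Qed.

End BoundedFunctional.

(** * Functionals with the eigenvalue property on point masses *)

Section EigenFunctional.
Context {R : realType} {m d : nat} {P : 'rV[nat]_m -> mpoly d R[i]}.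
Context {mu : probability (borelC R d) R}.
Context {g : 'rV[nat]_m -> 'rV[nat]_m -> 'rV[nat]_m -> R[i]}.
Context {inv : 'rV[nat]_m -> 'rV[nat]_m}.
Hypothesis hP : polynomial_hypergroup P mu g inv.
Local Notation K := 'rV[nat]_m.
Local Notation poly := (mpoly d R[i]).
Local Notation L p := (cintegral mu (peval p : borelC R d -> R[i])).
Variables (x : 'rV[R[i]]_d) (M : (K -> R[i]) -> R[i]).
Hypothesis bM : bounded_functional M.
Hypothesis eigM : forall f n, linf f -> M (translation g n f) = alpha P x n * M f.
Local Notation delta j := (fun k : K => (k == j)%:R : R[i]).

(* If [p = \sum_t c t *: P t], then [j |-> L (p * P j)] is
   [\sum_t c t *: translation g t (delta 0)]. *)
Lemma eigenfunctional_fourier (p : poly) :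
  linf (fun j => L (p * P j)) /\
  M (fun j => L (p * P j)) = peval p x * M (delta 0).
Proof.
elim/(mpoly_ind_basis hP): p => [|t|c p q [lp Mp] [lq Mq]].
- under eq_fun do rewrite mul0r (cintegral_peval0 hP).
  by split; [exact: linf0|rewrite bounded_functional0// /peval meval0 mul0r].
- have -> : (fun j => L (P t * P j)) = translation g t (delta 0).
    by apply/funext => j; rewrite translation_delta (linearization_coef0 hP).
  split; last exact/eigM/linf_delta.
  (* The coefficient lies between 0 and the value 1 of [P t * P j] at the normalization point
     [u]. *)
  exists 1 => j; rewrite translation_delta (linearization_coef0 hP).
  have [u Pu] := ph_normalized hP.
  have := positive_comb_integral hP _ u Pu (positive_combM hP _ _
    (positive_comb_basis t) (positive_comb_basis j)).
  rewrite pevalM !Pu mulr1 => /andP[L0 L1].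
  by move: (L1); rewrite -[X in X <= _](ger0_norm L0) normc_def lecR; case: (L _).
- under eq_fun do rewrite mulrDl -scalerAl (cintegral_pevalD hP).
  split; last first.
    apply: etrans (proj1 bM c _ _ lp lq) _.
    by rewrite pevalD pevalZ mulrDl -mulrA; congr (_ * _ + _); [exact: Mp|exact: Mq].
  have [B pB] := lp; have [B' qB] := lq; exists (modulus c * B + B') => k.
  apply: le_trans (le_normcD _ _) _; rewrite lerD// ComplexField.Normc.normcM.
  by rewrite ler_wpM2l ?modulus_ge0.
Qed.

(** For a strict peak [q], the functions [j |-> L (q ^+ k * P j)] all have the same image
    [M (delta 0)], because [q] is 1 at [x], yet their uniform norms are at most twice the integral
    of [q ^+ k]. *)
Lemma eigenfunctional_delta0 : hermitian_dual P inv x -> mu [set x] = 0%E ->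
  M (delta 0) = 0.
Proof.
move=> hx mux; have [q [qx q01]] := exists_strict_peak hP x hx mux.
have [C C0 MC] := bounded_functional_le M bM.
apply: ComplexField.Normc.eq0_normc; apply/eqP; rewrite eq_le modulus_ge0 andbT.
apply/ler_addgt0Pl => e e0; rewrite addr0.
(* [C] bounds the functional, 2 comes from the modulus estimate of complex integrals, and 1 ensures
   positivity. *)
have D0 : 0 < C * 2 + 1 by rewrite ltr_wpDl// mulr_ge0.
(* The order of [R[i]] forces [q] to be real where it lies in [0, 1), so its powers can be treated
   as real functions. *)
have qRe (z : borelC R d) : 0 <= peval q z < 1 ->
    peval q z = (complex.Re (peval q z))%:C%C /\ 0 <= complex.Re (peval q z) < 1.
  case: (peval q z) => a b; rewrite lecE ltcE /=.
  by move=> /andP[/andP[/eqP-> a0] /andP[_ a1]]; rewrite a0 a1.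
have [|k|||k qk] := @Rintegral_powers_small _ _ _ mu
  (fun z : borelC R d => complex.Re (peval q z))
  (fun k (z : borelC R d) => complex.Re (peval (q ^+ k) z)) (e / (C * 2 + 1)).
- exact: divr_gt0.
- by have [] := cintegrable_peval hP (q ^+ k).
- apply: filterS q01 => z /qRe[zE _] k.
  by rewrite pevalXn zE -real_complexXn.
- by apply: filterS q01 => z /qRe[].
have [_ Mq] := eigenfunctional_fourier (q ^+ k).
rewrite pevalXn qx expr1n mul1r in Mq; rewrite -Mq.
set I := Rintegral _ _ _ in qk.
have bnd j : modulus (L (q ^+ k * P j)) <= 2 * I.
  apply: modulus_cintegral_le; first exact: (cintegrable_peval hP).
    by have [] := cintegrable_peval hP (q ^+ k).
  apply: filterS2 q01 (ae_basis_le1 hP j) => z /qRe[zE /andP[z0 _]] jz.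
  rewrite pevalM ComplexField.Normc.normcM pevalXn zE -real_complexXn /=.
  by rewrite expr0n addr0 sqrtr_sqr ger0_norm ?exprn_ge0// ler_piMr// exprn_ge0.
apply: le_trans (MC _ _ bnd) _; rewrite mulrA.
apply: le_trans (ler_wpM2l _ (ltW qk)) _; first by rewrite mulr_ge0.
by rewrite mulrA ler_pdivrMr// mulrC ler_pM2l// lerDl.
Qed.

(** The translate of [delta 0] by [inv j] is [k |-> g (inv j) k 0]; as [inv] is injective, it is
    nonzero only at [k = j]. *)
Lemma eigenfunctional_delta (j : K) : M (delta 0) = 0 -> M (delta j) = 0.
Proof.
move=> M0; have [gj gn] := linearization_coef0_inv hP (inv j) j.
have := eigM _ (inv j) (linf_delta 0); rewrite M0 mulr0.
have -> : translation g (inv j) (delta 0) =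
    fun k => g (inv j) j 0 * (k == j)%:R + 0.
  apply/funext => k; rewrite translation_delta addr0.
  case: eqP => [->|kj]; first by rewrite mulr1.
  rewrite mulr0; have [_ ->//] := linearization_coef0_inv hP (inv j) k.
  by move/(bij_inj (ph_inv_bij hP))/esym.
rewrite (proj1 bM _ _ _ (linf_delta j) linf0) bounded_functional0// addr0.
by move/eqP; rewrite mulf_eq0 (negPf gj) => /eqP.
Qed.

End EigenFunctional.

(** * Contradiction between [M] vanishing on functions that vanish at infinity and its value 1 at
    the character *)

Theorem theorem2p1 (R : realType) (m d : nat)
  (P : 'rV[nat]_m -> mpoly d R[i])
  (pi : probability (borelC R d) R)
  (g : 'rV[nat]_m -> 'rV[nat]_m -> 'rV[nat]_m -> R[i])
  (inv : 'rV[nat]_m -> 'rV[nat]_m)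
  (x : 'rV[R[i]]_d)
  (m_gt0 : (0 < m)%N) (d_gt0 : (0 < d)%N)
  (hP : polynomial_hypergroup P pi g inv)
  (hx : hermitian_dual P inv x)
  (pi_x : pi [set x] = 0%E)
  (alpha_C0 : vanishes_at_infinity (alpha P x)) :
  ~ amenable g (alpha P x).
Proof.
move=> [M [bM Ma eigM]].
have M0 := eigenfunctional_delta0 hP x M bM eigM hx pi_x.
have Mdelta j := eigenfunctional_delta hP x M bM eigM j M0.
by have /eqP := bounded_functional_C0 M bM _ alpha_C0 Mdelta; rewrite Ma oner_eq0.
Qed.
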